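(* Let $G$ be a topological group and let $\alpha$ be a size of $G$. For each of the following properties, either every second countable t.d.l.c. completion of $G$ of size $\alpha$ has the property, or every second countable t.d.l.c. completion of $G$ of size $\alpha$ fails to have the property: (1) being elementary; (2) being elementary with transfinite rank $\beta$ (for a given transfinite ordinal $\beta$).
   Context: Topological groups are Hausdorff. A t.d.l.c. group is a totally disconnected, locally compact (Hausdorff) topological group; t.d.l.c.s.c. means additionally second countable. A (t.d.l.c.) completion map is a continuous homomorphism $\phi:G\rightarrow H$ with dense image such that $H$ is a t.d.l.c. group; $H$ is then called a t.d.l.c. completion of $G$. Two subgroups $U,V$ of a group are commensurate if $U\cap V$ has finite index in both. A subgroup $W\le G$ is commensurated in $G$ if $W$ is commensurate with $gWg^{-1}$ for all $g\in G$. For $U\le G$, $[U]$ is the set of closed subgroups of $G$ commensurate with $U$; it is called a size of $G$ if some (equivalently, any) $W\in[U]$ is commensurated in $G$. If $\phi:G\rightarrow H$ is a completion map and $R$ is a compact open subgroup of $H$, the size of $\phi$ (or of $H$) is $[\phi^{-1}(R)]$, which does not depend on the choice of $R$. The class $\mathscr{E}$ of elementary groups is the smallest class of t.d.l.c.s.c. groups such that: (i) $\mathscr{E}$ contains all second countable profinite groups and all countable discrete groups; (ii) $\mathscr{E}$ is closed under taking closed subgroups; (iii) $\mathscr{E}$ is closed under taking Hausdorff quotients; (iv) $\mathscr{E}$ is closed under forming group extensions; (v) if $K$ is a t.d.l.c.s.c. group and $K=\bigcup_{i\in\mathbb{N}}O_i$ with $(O_i)_{i\in\mathbb{N}}$ an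 increasing sequence of open subgroups with each $O_i\in\mathscr{E}$, then $K\in\mathscr{E}$. The rank of an elementary group is its decomposition rank $\xi$, the (successor) ordinal-valued function on $\mathscr{E}$, invariant under topological isomorphism, determined by: $\xi(\{1\})=1$; and if $K\in\mathscr{E}$ is non-trivial and $K=\bigcup_{i\in\mathbb{N}}O_i$ with $(O_i)_{i\in\mathbb{N}}$ an increasing sequence of compactly generated open subgroups of $K$, then $\xi(K)=\left(\sup_{i\in\mathbb{N}}\xi(\mathrm{Res}(O_i))\right)+1$, where $\mathrm{Res}(O):=\bigcap\{P\trianglelefteq O\mid P \text{ open in } O\}$ is the discrete residual. It is known that $\xi$ is well defined on $\mathscr{E}$. A rank is transfinite if it is an infinite ordinal. *)

(* Defs.v *)
From HB Require Import structures.
From mathcomp Require Import all_boot all_classical topology.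

Set Implicit Arguments.
Unset Strict Implicit.
Unset Printing Implicit Defensive.

Local Open Scope classical_set_scope.
Local Open Scope group_scope.

(* Topological groups are Hausdorff by convention. *)
HB.mixin Record isTopologicalGroup G of Topological G & Group G := {
  mulg_continuous : continuous (fun x : G * G => x.1 * x.2);
  invg_continuous : continuous (fun x : G => x^-1);
  topgroup_hausdorff : hausdorff_space G
}.

#[short(type="topGroupType")]
HB.structure Definition TopologicalGroup :=
  {G of Topological G & Group G & isTopologicalGroup G}.

Section Subgroups.
Context {G : topGroupType}.
Implicit Types (A C O P U V W : set G).

Definition is_subgroup A : Prop :=
  A 1 /\ forall x y, A x -> A y -> A (x / y).

Definition normal_in P O : Prop :=
  [/\ is_subgroup P, P `<=` O & forall g x, O g -> P x -> P (g * x * g^-1)].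

Definition generated C : set G :=
  \bigcap_(H in [set H | is_subgroup H /\ C `<=` H]) H.

Definition compactly_generated A : Prop :=
  exists2 C, compact C & A = generated C.

(* "[P] is open in [O]" refers to the subspace topology of [O]. *)
Definition discrete_residual O : set G :=
  \bigcap_(P in [set P | normal_in P O /\
                         exists2 V, open V & P = O `&` V]) P.

(* For [W] a subgroup of [V]: there are finitely many left cosets [x W], [x]
   in [V]. *)
Definition finite_index W V : Prop :=
  finite_set [set [set x * w | w in W] | x in V].

Definition commensurate U V : Prop :=
  finite_index (U `&` V) U /\ finite_index (U `&` V) V.

Definition commensurated W : Prop :=
  forall g : G, commensurate W [set g * w * g^-1 | w in W].

Definition comm_class U : set (set G) :=
  [set W | [/\ is_subgroup W, closed W & commensurate W U]].

Definition is_size (alpha : set (set G)) : Prop :=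
  exists U, [/\ is_subgroup U, alpha = comm_class U &
                exists2 W, alpha W & commensurated W].

End Subgroups.

Definition tdlc (G : topGroupType) : Prop :=
  totally_disconnected [set: G] /\ locally_compact [set: G].

Definition tdlcsc (G : topGroupType) : Prop :=
  tdlc G /\ @second_countable G.

Definition profinite (G : topGroupType) : Prop :=
  compact [set: G] /\ totally_disconnected [set: G].

Definition completion_map (G H : topGroupType) (phi : G -> H) : Prop :=
  [/\ tdlc H, monoid_morphism phi, continuous phi & dense (range phi)].

(* The class on the right does not depend on [R], and a compact open subgroup
   [R] exists in every t.d.l.c. group. *)
Definition completion_of_size (G H : topGroupType) (phi : G -> H)
    (alpha : set (set G)) : Prop :=
  completion_map phi /\
  exists R : set H, [/\ is_subgroup R, compact R, open R &
                        alpha = comm_class (phi @^-1` R)].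

Definition sc_completion_of_size (G : topGroupType) (alpha : set (set G))
    (H : topGroupType) : Prop :=
  @second_countable H /\
  exists phi : G -> H, completion_of_size phi alpha.

(* [e] identifies the topological group [H] with the subgroup [A] of [G],
   equipped with the subspace topology. *)
Definition realizes (H G : topGroupType) (e : H -> G) (A : set G) : Prop :=
  [/\ monoid_morphism e, injective e, range e = A &
      @open H = [set e @^-1` B | B in @open G]].

(* [q] identifies the topological group [Q] with the quotient of [G] by the
   kernel of [q], equipped with the quotient topology. *)
Definition quotient_map (G Q : topGroupType) (q : G -> Q) : Prop :=
  [/\ monoid_morphism q, range q = [set: Q] &
      forall B : set Q, open B <-> open (q @^-1` B)].

Definition exhaustion (K : topGroupType) (O : nat -> set K) : Prop :=
  [/\ forall i, is_subgroup (O i) /\ open (O i),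
      forall i j, (i <= j)%N -> O i `<=` O j &
      \bigcup_i O i = [set: K]].

(* Subgroups and quotients are taken up to topological isomorphism, so that
   the class is invariant under topological isomorphism. *)
Inductive elementary : topGroupType -> Prop :=
| elementary_profinite (K : topGroupType) :
    tdlcsc K -> profinite K -> elementary K
| elementary_discrete (K : topGroupType) :
    tdlcsc K -> countable [set: K] -> (forall A : set K, open A) ->
    elementary K
| elementary_closed_subgroup (G K : topGroupType) (A : set G) (e : K -> G) :
    tdlcsc K -> elementary G -> closed A -> realizes e A -> elementary K
| elementary_quotient (G K : topGroupType) (q : G -> K) :
    tdlcsc K -> elementary G -> quotient_map q -> elementary K
| elementary_extension (N K Q : topGroupType) (e : N -> K) (q : K -> Q) :
    tdlcsc K -> quotient_map q -> realizes e (q @^-1` [set 1]) ->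
    elementary N -> elementary Q -> elementary K
| elementary_union (K : topGroupType) (O : nat -> set K)
    (E : nat -> topGroupType) (e : forall i, E i -> K) :
    tdlcsc K -> exhaustion O -> (forall i, realizes (@e i) (O i)) ->
    (forall i, elementary (E i)) -> elementary K.

(* Ordinals as well-founded trees: [lsub f] is the least ordinal strictly above
   all [f i].  Distinct trees may denote the same ordinal; equality of ordinals
   is [oeq]. *)
Inductive ord : Type := lsub (X : Type) (f : X -> ord).

Fixpoint ole (a b : ord) : Prop :=
  match a, b with
  | lsub X f, lsub Y g => forall i : X, exists j : Y, ole (f i) (g j)
  end.

Definition oeq (a b : ord) : Prop := ole a b /\ ole b a.

Definition ozero : ord := lsub (fun x : Empty_set => match x with end).
Definition osucc (a : ord) : ord := lsub (fun _ : unit => a).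
Definition ord_of_nat (n : nat) : ord := iter n osucc ozero.
Definition omega : ord := lsub ord_of_nat.

Definition transfinite (b : ord) : Prop := ole omega b.

Definition branch (a : ord) : Type := match a with lsub X _ => X end.
Definition subtree (a : ord) : branch a -> ord :=
  match a with lsub _ f => f end.

(* The supremum is the union of the ordinals [a i]. *)
Definition osup (a : nat -> ord) : ord :=
  lsub (fun p : {i : nat & branch (a i)} => subtree (projT2 p)).

(* [decomposition_rank K b] is the graph of the rank function: [xi(K) = b]. *)
Inductive decomposition_rank : topGroupType -> ord -> Prop :=
| rank_trivial (K : topGroupType) (b : ord) :
    [set: K] = [set 1] -> oeq b (osucc ozero) -> decomposition_rank K b
| rank_nontrivial (K : topGroupType) (O : nat -> set K)
    (E : nat -> topGroupType) (e : forall i, E i -> K)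
    (a : nat -> ord) (b : ord) :
    elementary K -> [set: K] <> [set 1] ->
    exhaustion O -> (forall i, compactly_generated (O i)) ->
    (forall i, realizes (@e i) (discrete_residual (O i))) ->
    (forall i, decomposition_rank (E i) (a i)) ->
    oeq b (osucc (osup a)) -> decomposition_rank K b.

(* Main.v *)
Require Import Defs.
From HB Require Import structures.
From mathcomp Require Import all_boot all_classical topology.

Set Implicit Arguments.
Unset Strict Implicit.
Unset Printing Implicit Defensive.

Local Open Scope classical_set_scope.
Local Open Scope group_scope.

(** The theorem holds because any two second countable completions [K], [L] of
    [G] of the same size have a common cover: a t.d.l.c.s.c. group [E] with
    proper surjective morphisms, hence quotient maps with compact kernel, onto
    both; and neither elementarity nor an infinite decomposition rank can see
    a compact kernel.

    The cover ([common_cover]) is the closure of the image of [G] in [K * L].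
    If [R] and [S] are compact open subgroups of [K] and [L], equality of the
    sizes makes the preimages [U] of [R] and [V] of [S] commensurate, so the
    image of [U] in [L] is contained in finitely many cosets of [S].  Therefore
    the part of the cover lying above [R] is compact, and a morphism with dense
    image and one compact preimage of an open subgroup is proper and onto.

    Let now [q : H -> Q] be a proper surjection.  Its kernel is profinite, so
    [H] is elementary if and only if [Q] is: one direction is closure under
    extensions, the other closure under quotients.  For the rank, an exhaustion
    by compactly generated open subgroups can be pushed forward and pulled back
    along [q], and [q] maps the discrete residual of an open subgroup [O] onto
    that of [q O] ([residual_image], a compactness argument in the fibres).  So
    [q] restricts to proper surjections between the residuals, and induction on
    a derivation of the rank of one group produces a rank of the other one,
    with [rank Q <= rank H <= 1 + rank Q].  The summand arises at the bottom of
    the induction, where [Q] is trivial and [H] is profinite: then [rank Q = 1],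
    while [rank H <= 2] because a profinite group has trivial residual.  Since
    [1 + b = b] for infinite [b], the two ranks agree as soon as one of them is
    infinite ([rank_transfinite_proper]). *)

(** * Ordinals *)

Lemma ole_refl (a : ord) : ole a a.
Proof. by elim: a => X f IH /= i; exists i. Qed.

Lemma ole_trans (b a c : ord) : ole a b -> ole b c -> ole a c.
Proof.
elim: b a c => Y g IH [X f] [Z h] /= fg gh i.
have [j fgij] := fg i; have [k ghjk] := gh j.
by exists k; apply: IH fgij ghjk.
Qed.

Lemma oeq_sym (a b : ord) : oeq a b -> oeq b a.
Proof. by case. Qed.

Lemma oeq_trans (b a c : ord) : oeq a b -> oeq b c -> oeq a c.
Proof. by move=> [ab ba] [bc cb]; split; apply: (@ole_trans b). Qed.

Lemma ole_total (a b : ord) : ole a b \/ ole b a.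
Proof.
elim: a b => X f IH [Y g] /=.
have [?|/existsNP[i /forallNP fig]] :=
  pselect (forall i, exists j, ole (f i) (g j)); first by left.
by right=> j; exists i; have [/fig|] := IH i (g j).
Qed.

Lemma ole0 (a : ord) : ole ozero a.
Proof. by case: a => X f []. Qed.

Lemma ole_succ (a b : ord) : ole (osucc a) (osucc b) <-> ole a b.
Proof. by split=> [/(_ tt)[]//|ab i]; exists tt. Qed.

Lemma ole_sup (a b : nat -> ord) :
  (forall i, ole (a i) (b i)) -> ole (osup a) (osup b).
Proof.
move=> ab [i x] /=; move: x (ab i).
case ai : (a i) => [X f]; case bi : (b i) => [Y g] /= x /(_ x)[y fxgy].
have yE : exists y' : branch (b i), ole (f x) (subtree y').
  by rewrite bi; exists y.
by have [y' ?] := yE; exists (existT _ i y').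
Qed.

Lemma osup_le (a : nat -> ord) (b : ord) :
  (forall i, ole (a i) b) -> ole (osup a) b.
Proof.
case: b => Y g ab [i x] /=; move: x (ab i).
by case: (a i) => X f /= x; apply.
Qed.

(** The ordinal [1 + a]; adding on the left is what makes an infinite [a]
    absorb the summand. *)
Fixpoint oadd1 (a : ord) : ord :=
  match a with
  | lsub X f => lsub (fun i : option X => if i is Some x then oadd1 (f x)
                                          else ozero)
  end.

Lemma oadd1_mono (a b : ord) : ole a b -> ole (oadd1 a) (oadd1 b).
Proof.
elim: a b => X f IH [Y g] /= fg [i|]; last by exists None; exact: ole0.
by have [j fgij] := fg i; exists (Some j); apply: IH.
Qed.

Lemma oadd1_succ (a : ord) : ole (osucc (oadd1 a)) (oadd1 (osucc a)).
Proof. by move=> _; exists (Some tt); exact: ole_refl. Qed.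

Lemma oadd1_sup (a : nat -> ord) :
  ole (osup (fun i => oadd1 (a i))) (oadd1 (osup a)).
Proof.
move=> [i x] /=; move: x; case ai : (a i) => [X f] /= [x|]; last first.
  by exists None; exact: ole0.
have [y yE] : exists y : branch (a i), oadd1 (f x) = oadd1 (subtree y).
  by rewrite ai; exists x.
by exists (Some (existT _ i y)); rewrite yE; exact: ole_refl.
Qed.

Lemma oadd1_nat (n : nat) : ole (oadd1 (ord_of_nat n)) (ord_of_nat n.+1).
Proof.
elim: n => [|n IH]; first by move=> [[]|]; exists tt.
by move=> [[]|]; exists tt => //; exact: ole0.
Qed.

Lemma not_transfinite (a : ord) :
  ~ transfinite a -> exists n, ole a (ord_of_nat n).
Proof.
case: a => X f /existsNP[n /forallNP nf]; exists n.+1.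
rewrite /ord_of_nat iterS => i; exists tt.
by have [/nf|] := ole_total (ord_of_nat n) (f i).
Qed.

(** An infinite member of [b] absorbs the summand by induction, and a finite
    one moves up to a finite ordinal, below some member of [b] again. *)
Lemma oadd1_transfinite (b : ord) : transfinite b -> ole (oadd1 b) b.
Proof.
elim: b => X f IH om; move: (om); rewrite /transfinite /= => omX.
case=> [x|]; last by have [j _] := omX 0%N; exists j; exact: ole0.
have [fx|/not_transfinite[n fxn]] := pselect (transfinite (f x)).
  by exists x; exact: IH.
have [j jn] := omX n.+1; exists j.
by apply: ole_trans jn; apply: ole_trans (oadd1_nat n); exact: oadd1_mono.
Qed.

Lemma transfinite_nat (n : nat) : ~ transfinite (ord_of_nat n).
Proof.
move=> om; have : ole (ord_of_nat n.+1) (ord_of_nat n).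
  apply: (ole_trans _ om); rewrite /ord_of_nat iterS => _.
  by exists n; exact: ole_refl.
by elim: n {om} => [/(_ tt)[[]]|n IH /ole_succ].
Qed.

Lemma transfinite_oadd1 (b : ord) : transfinite (oadd1 b) -> transfinite b.
Proof.
move=> om; apply: contrapT => /not_transfinite[n bn].
apply: (@transfinite_nat n.+1); apply: ole_trans om _.
by apply: ole_trans (oadd1_nat n); exact: oadd1_mono.
Qed.

(** This is how the bounds obtained for the ranks of a group and of its
    quotient by a compact subgroup become an equality. *)
Lemma oeq_transfinite (b c : ord) :
  ole c b -> ole b (oadd1 c) -> transfinite c -> oeq b c.
Proof.
move=> cb bc tc; split=> //.
by apply: ole_trans bc _; exact: oadd1_transfinite.
Qed.

(** * Topological groups and their subgroups *)

Section Continuity.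
Context {T : topologicalType} {G : topGroupType}.
Implicit Types f g : T -> G.

Lemma continuousM f g :
  continuous f -> continuous g -> continuous (fun x => f x * g x).
Proof.
move=> cf cg x; apply: (@continuous2_cvg _ _ _ _ _ _ f g mul).
- exact: (@mulg_continuous G (f x, g x)).
- exact: cf.
- exact: cg.
Qed.

Lemma continuousV f : continuous f -> continuous (fun x => (f x)^-1).
Proof.
by move=> cf x; apply: continuous_comp (cf x) (@invg_continuous G _). Qed.

End Continuity.

Lemma continuous_ltransl (G : topGroupType) (a : G) :
  continuous (fun x : G => a * x).
Proof.
by apply: (@continuousM _ _ (fun=> a) id); [exact: cst_continuous|move=> x].
Qed.

Section SubgroupFacts.
Context {G : topGroupType}.
Implicit Types (A C O P U V W : set G).

Lemma subgroup1 A : is_subgroup A -> A 1.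
Proof. by case. Qed.

Lemma subgroupV A x : is_subgroup A -> A x -> A x^-1.
Proof. by move=> [A1 AB] Ax; rewrite -[x^-1]mul1g; apply: AB. Qed.

Lemma subgroupM A x y : is_subgroup A -> A x -> A y -> A (x * y).
Proof.
by move=> sA Ax Ay; rewrite -[y]invgK; apply: (sA.2) => //; exact: subgroupV.
Qed.

Lemma subgroupI A C : is_subgroup A -> is_subgroup C -> is_subgroup (A `&` C).
Proof.
move=> [A1 AB] [C1 CB]; split=> // x y [Ax Cx] [Ay Cy].
by split; [exact: AB | exact: CB].
Qed.

Lemma subgroup_bigcap (D : set (set G)) :
  (forall A, D A -> is_subgroup A) -> is_subgroup (\bigcap_(A in D) A).
Proof.
move=> sD; split=> [A DA|x y Dx Dy A DA]; first by case: (sD A DA).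
by apply: (sD A DA).2; [exact: Dx | exact: Dy].
Qed.

Lemma generated_subgroup C : is_subgroup (generated C).
Proof. by apply: subgroup_bigcap => A []. Qed.

Lemma open_ltransl (a : G) O : open O -> open [set x | O (a * x)].
Proof. by move: O; apply/continuousP; exact: continuous_ltransl. Qed.

Lemma nbhs1_subgroup_open A : is_subgroup A -> nbhs 1 A -> open A.
Proof.
move=> sA A1; rewrite openE => x Ax.
have : nbhs x [set y | A (x^-1 * y)].
  by apply: continuous_ltransl; rewrite mulVg.
apply: filterS => y /= Axy.
by rewrite -[y](mulVKg x); apply: subgroupM.
Qed.

Lemma open_subgroup_closed A : is_subgroup A -> open A -> closed A.
Proof.
move=> sA oA x clx; have nx : nbhs x [set y | A (x^-1 * y)].
  apply: open_nbhs_nbhs; split; first exact: open_ltransl.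
  by rewrite /= mulVg; exact: subgroup1.
have [y [Ay Axy]] := clx _ nx.
have -> : x = y / (x^-1 * y) by rewrite invgM invgK mulVKg.
exact: sA.2.
Qed.

Lemma subgroup_conj O : is_subgroup O -> forall x y, O x -> O y ->
  O (x * y * x^-1).
Proof.
by move=> sO x y Ox Oy; apply: sO.2 => //; exact: subgroupM.
Qed.

End SubgroupFacts.

Section Morphisms.
Context {G H : topGroupType} (f : G -> H).
Hypothesis mf : monoid_morphism f.

Lemma morphism1 : f 1 = 1. Proof. exact: mf.1. Qed.

Lemma morphismM x y : f (x * y) = f x * f y. Proof. exact: mf.2. Qed.

Lemma morphismV x : f x^-1 = (f x)^-1.
Proof. by apply: (mulgI (f x)); rewrite -morphismM !mulgV morphism1. Qed.

Lemma preimage_subgroup (A : set H) : is_subgroup A -> is_subgroup (f @^-1` A).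
Proof.
move=> sA; split=> [|x y /= Ax Ay]; first by rewrite /= morphism1; apply: sA.1.
by rewrite morphismM morphismV; apply: sA.2.
Qed.

Lemma image_subgroup (A : set G) : is_subgroup A -> is_subgroup (f @` A).
Proof.
move=> sA; split=> [|_ _ [x Ax <-] [y Ay <-]].
  by exists 1; [exact: sA.1 | exact: morphism1].
by exists (x / y); [exact: sA.2 | rewrite morphismM morphismV].
Qed.

End Morphisms.

(** * The discrete residual *)

Section Residual.
Context {G : topGroupType}.
Implicit Types (O P : set G).

Lemma normal_self O : is_subgroup O -> normal_in O O.
Proof. by move=> sO; split=> // g x *; exact: subgroup_conj. Qed.

Lemma residualP O x : open O ->
  discrete_residual O x <-> forall P, normal_in P O -> open P -> P x.
Proof.
move=> oO; split=> Rx P.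
  move=> nP oP; apply: Rx; split=> //; exists P => //.
  by case: nP => _ PO _; rewrite setIidr.
by move=> [nP [V oV PE]]; apply: Rx => //; rewrite PE; exact: openI.
Qed.

Lemma residual_subgroup O : is_subgroup (discrete_residual O).
Proof. by apply: subgroup_bigcap => P [[]]. Qed.

Lemma residual_closed O : is_subgroup O -> open O ->
  closed (discrete_residual O).
Proof.
move=> sO oO; apply: closed_bigI => P [[sP PO _] [V oV PE]].
by apply: open_subgroup_closed => //; rewrite PE; exact: openI.
Qed.

Lemma residualS (O1 O2 : set G) : is_subgroup O1 -> O1 `<=` O2 ->
  discrete_residual O1 `<=` discrete_residual O2.
Proof.
move=> sO O12 x Rx P [[sP PO nP] [V oV PE]].
have : (O1 `&` P) x.
  apply: Rx; split; last first.
    by exists V => //; rewrite PE setIA [O1 `&` O2]setIidl.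
  split; [exact: subgroupI | exact: subIsetl|].
  move=> g y Og [Oy Py]; split; first exact: subgroup_conj.
  by apply: nP => //; exact: O12.
by case.
Qed.

End Residual.

(** * Subgroups and products as topological groups *)

(** The proof that [A] is a subgroup is an argument of the type: the group
    structure on the elements of [A] depends on it. *)
Definition subgroup_type (G : topGroupType) (A : set G) (sA : is_subgroup A) :
  Type := initial_topology (@set_val G A).

Section SubgroupType.
Context {G : topGroupType} {A : set G} (sA : is_subgroup A).
Local Notation S := (subgroup_type sA).

Definition sub_elt (x : G) (Ax : A x) : S := exist _ x (mem_set Ax).

Definition sub_val (x : S) : G := set_val x.

Lemma sub_valP (x : S) : A (sub_val x).
Proof. exact: set_valP. Qed.

Lemma sub_val_inj : injective sub_val.
Proof. exact: val_inj. Qed.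

Let one := sub_elt sA.1.
Let mulS (x y : S) := sub_elt (subgroupM sA (sub_valP x) (sub_valP y)).
Let invS (x : S) := sub_elt (subgroupV sA (sub_valP x)).

HB.instance Definition _ := Topological.on S.

Fact sub_mulgA : associative mulS.
Proof. by move=> x y z; apply: sub_val_inj; exact: mulgA. Qed.
Fact sub_mul1g : left_id one mulS.
Proof. by move=> x; apply: sub_val_inj; exact: mul1g. Qed.
Fact sub_mulg1 : right_id one mulS.
Proof. by move=> x; apply: sub_val_inj; exact: mulg1. Qed.
Fact sub_mulVg : left_inverse one invS mulS.
Proof. by move=> x; apply: sub_val_inj; exact: mulVg. Qed.
Fact sub_mulgV : right_inverse one invS mulS.
Proof. by move=> x; apply: sub_val_inj; exact: mulgV. Qed.

HB.instance Definition _ :=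
  isGroup.Build S sub_mulgA sub_mul1g sub_mulg1 sub_mulVg sub_mulgV.

Lemma sub_val_continuous : continuous sub_val.
Proof. exact: initial_continuous. Qed.

Lemma continuous_to_sub (T : topologicalType) (f : T -> S) :
  continuous (sub_val \o f) -> continuous f.
Proof.
move=> cf; apply/continuousP => _ [B oB <-]; rewrite -comp_preimage.
by move/continuousP: cf; apply.
Qed.

Fact sub_mul_continuous : continuous (fun x : S * S => x.1 * x.2).
Proof.
apply: continuous_to_sub; apply: (@continuousM _ G) => x.
  by apply: (@continuous_comp _ _ _ fst);
    [exact: cvg_fst|exact: sub_val_continuous].
by apply: (@continuous_comp _ _ _ snd);
  [exact: cvg_snd|exact: sub_val_continuous].
Qed.

Fact sub_inv_continuous : continuous (fun x : S => x^-1).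
Proof.
by apply: continuous_to_sub; apply: (@continuousV _ G);
  exact: sub_val_continuous.
Qed.

Fact sub_hausdorff : hausdorff_space S.
Proof.
move=> p q pq; apply: sub_val_inj; apply: (@topgroup_hausdorff G).
move=> U V pU qV; have [] := pq (sub_val @^-1` U) (sub_val @^-1` V).
- exact: sub_val_continuous pU.
- exact: sub_val_continuous qV.
by move=> x [Ux Vx]; exists (sub_val x).
Qed.

HB.instance Definition _ := isTopologicalGroup.Build S
  sub_mul_continuous sub_inv_continuous sub_hausdorff.

Lemma sub_val_realizes : realizes (sub_val : S -> G) A.
Proof.
split; [by [] | exact: sub_val_inj | | by []].
apply/seteqP; split=> [_ [x _ <-]|x Ax]; first exact: sub_valP.
by exists (sub_elt Ax).
Qed.

End SubgroupType.

Section ProductGroup.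
Context (G H : topGroupType).

Fact prod_mul_continuous : continuous (fun x : (G * H) * (G * H) => x.1 * x.2).
Proof.
have cf (T U : topologicalType) : continuous (@fst T U) by move=> ?;
  exact: cvg_fst.
have cs (T U : topologicalType) : continuous (@snd T U) by move=> ?;
  exact: cvg_snd.
have comp (T U V : topologicalType) (f : T -> U) (g : U -> V) :
    continuous f -> continuous g -> continuous (g \o f).
  by move=> fc gc x; apply: continuous_comp; [exact: fc | exact: gc].
move=> x; apply: cvg_pair => /=.
  apply: (@continuousM _ G (fst \o fst) (fst \o snd));
    by apply: comp; first [exact: cf | exact: cs].
apply: (@continuousM _ H (snd \o fst) (snd \o snd));
by apply: comp; first [exact: cf | exact: cs].
Qed.

Fact prod_inv_continuous : continuous (fun x : G * H => x^-1).
Proof.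
move=> x; apply: cvg_pair => /=.
  by apply: (@continuousV _ G (fun x => x.1)) => ?; exact: cvg_fst.
by apply: (@continuousV _ H (fun x => x.2)) => ?; exact: cvg_snd.
Qed.

Fact prod_hausdorff : hausdorff_space (G * H)%type.
Proof.
move=> [p1 p2] [q1 q2] pq; congr pair.
  apply: (@topgroup_hausdorff G) => U V pU qV.
  have [] := pq (fst @^-1` U) (fst @^-1` V).
  - exact: (@cvg_fst _ _ (nbhs p1) (nbhs p2)) pU.
  - exact: (@cvg_fst _ _ (nbhs q1) (nbhs q2)) qV.
  by move=> x [Ux Vx]; exists x.1.
apply: (@topgroup_hausdorff H) => U V pU qV.
have [] := pq (snd @^-1` U) (snd @^-1` V).
- exact: (@cvg_snd _ _ (nbhs p1) (nbhs p2)) pU.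
- exact: (@cvg_snd _ _ (nbhs q1) (nbhs q2)) qV.
by move=> x [Ux Vx]; exists x.2.
Qed.

HB.instance Definition _ := isTopologicalGroup.Build (G * H)%type
  prod_mul_continuous prod_inv_continuous prod_hausdorff.

End ProductGroup.

(** * Embeddings onto closed subgroups *)

Lemma locally_compactP (T : topologicalType) : hausdorff_space T ->
  locally_compact [set: T] <->
  forall x : T, exists2 K, nbhs x K & compact K.
Proof.
move=> hT; split=> [lc x|lc x _].
  have [K xK [cK _]] := lc x I; exists K => //.
  have {}xK : nbhs x [set y | [set: T] y -> K y] := xK.
  by apply: filterS xK => y; apply.
have [K xK cK] := lc x; exists K; last by split=> //; exact: compact_closed.
have : nbhs x [set y | [set: T] y -> K y] by apply: filterS xK => y Ky _.
exact.
Qed.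

Lemma image_compact (T U : topologicalType) (f : T -> U) (K : set T) :
  continuous f -> compact K -> compact (f @` K).
Proof.
by move=> cf; apply: continuous_compact; exact: continuous_subspaceT. Qed.

Section Realizes.
Context {E G : topGroupType} {e : E -> G} {A : set G}.
Hypothesis re : realizes e A.

Lemma realizes_inj : injective e. Proof. by case: re. Qed.

Lemma realizes_morphism : monoid_morphism e. Proof. by case: re. Qed.

Lemma realizes_range : range e = A. Proof. by case: re. Qed.

Lemma realizes_mem x : A (e x).
Proof. by rewrite -realizes_range; exists x. Qed.

Lemma realizes_open : @open E = [set e @^-1` B | B in @open G].
Proof. by case: re. Qed.

Lemma realizes_continuous : continuous e.
Proof. by apply/continuousP => B oB; rewrite realizes_open; exists B. Qed.

Lemma realizes_nbhs (x : E) (U : set E) :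
  nbhs x U -> exists2 V, nbhs (e x) V & e @^-1` V `<=` U.
Proof.
rewrite nbhsE => -[B [+ Bx] BU]; rewrite realizes_open => -[V oV VB].
by exists V; [apply: open_nbhs_nbhs; split=> //; rewrite -VB in Bx|rewrite VB].
Qed.

Lemma continuous_to_realizes (T : topologicalType) (f : T -> E) :
  continuous (e \o f) -> continuous f.
Proof.
move=> cf; apply/continuousP => U; rewrite realizes_open => -[B oB <-].
by rewrite -comp_preimage; move/continuousP: cf; apply.
Qed.

Lemma realizes_compact (K : set G) :
  compact K -> K `<=` A -> compact (e @^-1` K).
Proof.
move=> cK KA F PF FK.
have [|x [Kx clx]] := cK (e @ F) _; first exact: FK.
have := KA x Kx; rewrite -realizes_range => -[y _ yx];
  rewrite -{x}yx in Kx clx *.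
exists y; split=> // U V FU /realizes_nbhs[W eyW WV].
have [|_ [[z Uz <-] Wz]] := clx (e @` U) W _ eyW.
  by rewrite /= /nbhs /=; apply: filterS FU => z; exists z.
by exists z; split=> //; apply: WV.
Qed.

Lemma realizes_tdlcsc : tdlcsc G -> closed A -> tdlcsc E.
Proof.
move=> [[tdG lcG] [B cB [oB bB]]] cA; split; first split.
- move=> x _; apply/seteqP; split=> [y|_ ->];
    last exact: connected_component_refl.
  move=> [C [Cx _ coC] Cy]; apply: (realizes_inj).
  suff : connected_component [set: G] (e x) (e y) by rewrite tdG.
  exists (e @` C); last by exists y.
  split=> //.
  apply: connected_continuous_connected coC _.
  exact/continuous_subspaceT/realizes_continuous.
- apply/(locally_compactP (@topgroup_hausdorff E)) => x.
  have [K xK cK] := (locally_compactP (@topgroup_hausdorff G)).1 lcG (e x).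
  exists (e @^-1` (K `&` A)).
    have exK : nbhs x (e @^-1` K) by apply: realizes_continuous.
    by apply: filterS exK => y Ky; split=> //; exact: realizes_mem.
  apply: realizes_compact; last exact: subIsetr.
  exact: compact_closedI.
- exists [set e @^-1` V | V in B].
    by apply: card_le_trans cB; exact: card_image_le.
  split=> [_ [V BV <-]|x U /realizes_nbhs[V xV VU]].
    by rewrite realizes_open; exists V => //; exact: oB.
  have [W [BW Wx] WV] := bB _ _ xV; exists (e @^-1` W); last first.
    by move=> z Wz; apply: VU; apply: WV.
  by split=> //; exists W.
Qed.

End Realizes.

(** * Proper surjections *)

Definition proper_surjection (H Q : topGroupType) (q : H -> Q) : Prop :=
  [/\ monoid_morphism q, continuous q, range q = [set: Q] &
      forall K, compact K -> compact (q @^-1` K)].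

(** Around a point [y] of the closure of [f C], the set [C] may be replaced by
    its part above a compact neighbourhood of [y], whose image is compact. *)
Lemma proper_closed (S T : topologicalType) (f : S -> T) :
  hausdorff_space T -> locally_compact [set: T] -> continuous f ->
  (forall K, compact K -> compact (f @^-1` K)) ->
  forall C, closed C -> closed (f @` C).
Proof.
move=> hT /(locally_compactP hT) lcT cf pf C cC y cly.
have [K yK cK] := lcT y.
suff [x [_ Cx] <-] : (f @` (f @^-1` K `&` C)) y by exists x.
have : closed (f @` (f @^-1` K `&` C)).
  apply: compact_closed => //; apply: image_compact => //.
  by apply: compact_closedI => //; exact: pf.
apply=> U yU; have [_ [[x Cx <-] [Ux Kx]]] := cly _ (filterI yU yK).
by exists (f x); split=> //; exists x.
Qed.

Section Proper.
Context {H Q : topGroupType} {q : H -> Q}.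
Hypothesis (tQ : tdlcsc Q) (pq : proper_surjection q).

Lemma proper_morphism : monoid_morphism q. Proof. by case: pq. Qed.

Lemma proper_continuous : continuous q. Proof. by case: pq. Qed.

Lemma proper_surj y : exists x, q x = y.
Proof.
have [_ _ rq _] := pq; have : range q y by rewrite rq.
by case=> x; exists x.
Qed.

Lemma proper_compact K : compact K -> compact (q @^-1` K).
Proof. by case: pq => _ _ _; apply. Qed.

Lemma proper_closed_image C : closed C -> closed (q @` C).
Proof.
apply: proper_closed; [exact: topgroup_hausdorff|by case: tQ => -[]| |].
  exact: proper_continuous.
exact: proper_compact.
Qed.

(** A closed continuous surjection carries the quotient topology. *)
Lemma proper_quotient_map : quotient_map q.
Proof.
split=> [||B]; [exact: proper_morphism|by case: pq|].
split; first by move/continuousP: proper_continuous; apply.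
rewrite -[open (_ @^-1` _)]closedC -[open B]closedC => /proper_closed_image.
congr closed; apply/seteqP; split=> [_ [x nBx <-] //|y nBy].
by have [x xy] := proper_surj y; exists x => //=; rewrite xy.
Qed.

Lemma proper_open_image O : open O -> open (q @` O).
Proof.
move=> oO; have [_ _ ->] := proper_quotient_map.
(* The saturation of [O] is a union of translates of [O] by the kernel. *)
have -> : q @^-1` (q @` O) = \bigcup_(l in q @^-1` [set 1]) [set x | O (l * x)].
  apply/seteqP; split=> [x [y Oy yx]|x [l /= ql Olx]].
    exists (y / x); last by rewrite /= mulgVK.
    by rewrite /= (morphismM proper_morphism) (morphismV proper_morphism) yx
      mulgV.
  by exists (l * x) => //; rewrite (morphismM proper_morphism) ql mul1g.
by apply: bigcup_open => l _; exact: open_ltransl.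
Qed.

Lemma proper_kernel_compact : compact (q @^-1` [set 1]).
Proof. by apply: proper_compact; exact: compact_set1. Qed.

(** * Discrete residuals under proper surjections *)

Lemma normal_preimage P O : is_subgroup O -> normal_in P (q @` O) ->
  normal_in (O `&` q @^-1` P) O.
Proof.
move=> sO [sP PO nP]; split; [|exact: subIsetl|].
  by apply: subgroupI => //; exact: (preimage_subgroup proper_morphism).
move=> g x Og [Ox Px]; split; first exact: subgroup_conj.
rewrite /= !(morphismM proper_morphism) (morphismV proper_morphism).
by apply: nP => //; exists g.
Qed.

Lemma normal_image P O : normal_in P O -> normal_in (q @` P) (q @` O).
Proof.
move=> [sP PO nP]; split; [exact: (image_subgroup proper_morphism)| |].
  by move=> _ [x Px <-]; exists x => //; exact: PO.
move=> _ _ [g Og <-] [x Px <-]; exists (g * x * g^-1); first exact: nP.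
by rewrite !(morphismM proper_morphism) (morphismV proper_morphism).
Qed.

(** The inclusion from left to right holds for any quotient map.  Conversely,
    for [y] in the residual of [q O], every open normal subgroup [P] of [O]
    meets the fibre of [y], because [q P] is open and normal in [q O].  These
    [P] form a filtered family of closed sets and the fibre is compact, so
    their intersection meets the fibre as well. *)
Lemma residual_image O : is_subgroup O -> open O ->
  q @` discrete_residual O = discrete_residual (q @` O).
Proof.
move=> sO oO; have oqO := proper_open_image oO.
apply/seteqP; split=> [_ [x /(residualP _ oO) Rx <-]|y /(residualP _ oqO) Ry].
  apply/(residualP _ oqO) => P nP oP.
  have [|_ //] := Rx _ (normal_preimage sO nP) _.
  by apply: openI => //; move/continuousP: proper_continuous; apply.
pose N := [set P | normal_in P O /\ open P].
pose F := filter_from N (fun P => q @^-1` [set y] `&` P).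
have NO : N O by split=> //; exact: normal_self.
have FF : Filter F.
  apply: filter_from_filter; first by exists O.
  move=> P1 P2 [[s1 P1O n1] o1] [[s2 P2O n2] o2].
  exists (P1 `&` P2); last by move=> x [? []].
  split; last exact: openI.
  split; [exact: subgroupI|by move=> x [/P1O]|].
  by move=> g x Og [P1x P2x]; split; [exact: n1|exact: n2].
have PF : ProperFilter F.
  apply: filter_from_proper => P [nP oP].
  have [x Px <-] := Ry _ (normal_image nP) (proper_open_image oP).
  by exists x.
have [|x [qxy clx]] := proper_compact (@compact_set1 _ y) PF.
  by exists O => // x [].
exists x => //; apply/(residualP _ oO) => P nP oP.
have cP : closed P by case: nP => sP _ _; exact: open_subgroup_closed.
by apply: cP => U xU; apply: clx xU; exists P => // z [].
Qed.

Lemma image_generated C : q @` generated C = generated (q @` C).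
Proof.
have sC := generated_subgroup C.
apply/seteqP; split=> [_ [x Cx <-] A [sA CA]|y].
  apply: (Cx (q @^-1` A)); split;
    first exact: (preimage_subgroup proper_morphism).
  by move=> z Cz; apply: CA; exists z.
apply; split; first exact: (image_subgroup proper_morphism).
by move=> _ [x Cx <-]; exists x => // A [_]; apply.
Qed.

Lemma compactly_generated_image O :
  compactly_generated O -> compactly_generated (q @` O).
Proof.
move=> [C cC ->]; exists (q @` C); last exact: image_generated.
by apply: image_compact => //; exact: proper_continuous.
Qed.

(** The kernel is thrown into the generators, so that a subgroup containing
    them is a union of fibres. *)
Lemma compactly_generated_preimage O :
  compactly_generated O -> compactly_generated (q @^-1` O).
Proof.
move=> [C cC ->]; exists (q @^-1` (C `|` [set 1])).
  by apply: proper_compact; apply: compactU => //; exact: compact_set1.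
have mq := proper_morphism.
apply/seteqP; split=> [x Cx A [sA CA]|x Gx].
  have [|a Aa ax] := Cx (q @` A).
    split; first exact: (image_subgroup mq).
    move=> c Cc; have [z zc] := proper_surj c.
    by exists z => //; apply: CA; left; rewrite zc.
  rewrite -[x](mulVKg a); apply: subgroupM => //; apply: CA; right => /=.
  by rewrite (morphismM mq) (morphismV mq) ax mulVg.
apply: Gx; split; first exact: (preimage_subgroup mq (generated_subgroup C)).
move=> z [Cz|/= ->]; last exact: subgroup1 (generated_subgroup C).
by move=> A [_]; apply.
Qed.

(** Proper surjections restrict to closed subgroups, and the embeddings [e] and
    [e'] keep the abstract groups [E] and [E'] that occur in a derivation of
    the rank in place; this is the induction step for the rank. *)
Lemma proper_restrict (E E' : topGroupType) (e : E -> H) (e' : E' -> Q)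
    (A : set H) (B : set Q) :
  closed A -> q @` A = B -> realizes e A -> realizes e' B ->
  exists r : E -> E', proper_surjection r.
Proof.
move=> cA qA re re'.
have rE x : exists y, e' y = q (e x).
  have : B (q (e x)) by rewrite -qA; exists (e x) => //;
    exact: (realizes_mem re).
  by rewrite -(realizes_range re') => -[y]; exists y.
have [r rP] := choice rE; exists r; have ie' := realizes_inj re'.
have [me me'] := (realizes_morphism re, realizes_morphism re').
split.
- split=> [|x y]; apply: ie'; rewrite rP.
    by rewrite (morphism1 me) (morphism1 proper_morphism) (morphism1 me').
  by rewrite (morphismM me) (morphismM proper_morphism) (morphismM me') !rP.
- apply: (continuous_to_realizes re').
  have -> : e' \o r = q \o e by apply/funext => x /=.
  by move=> x; apply: continuous_comp;
    [exact: (realizes_continuous re)|exact: proper_continuous].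
- apply/seteqP; split=> // y _.
  have := realizes_mem re' y; rewrite -qA => -[a].
  rewrite -(realizes_range re) => -[x _ <-] qex.
  by exists x => //; apply: ie'; rewrite rP.
- move=> K cK.
  have -> : r @^-1` K = e @^-1` (q @^-1` (e' @` K) `&` A).
    apply/seteqP; split=> [x Kx|x [/= [y Ky yx] _]].
      split; last exact: (realizes_mem re).
      by exists (r x); rewrite // rP.
    by rewrite /= -(ie' y (r x)) // rP.
  apply: (realizes_compact re); last exact: subIsetr.
  apply: compact_closedI => //; apply: proper_compact.
  by apply: image_compact => //; exact: (realizes_continuous re').
Qed.

End Proper.

(** * Profinite groups *)

(** In a compact Hausdorff space quasi-components are connected.  If the
    quasi-component of [x] splits into two closed pieces, normality encloses
    them in disjoint open sets [U] and [V]; by compactness a single clopen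
    neighbourhood [D] of [x] lies in their union, and then [D `&` U] is a
    clopen neighbourhood of [x] that misses the other piece. *)
Lemma quasi_component_connected (T : topologicalType) (x : T) :
  hausdorff_space T -> compact [set: T] ->
  connected (\bigcap_(D in [set D | clopen D /\ D x]) D).
Proof.
move=> hT cT; set Q := \bigcap_(_ in _) _; apply/connectedP => E [E0 QE sE].
have cQ : closed Q by apply: closed_bigI => D [[]].
have Qx : Q x by move=> D [].
have QEb b : Q = E b `|` E (~~ b) by case: b => //=; rewrite setUC.
have clE b : closure (E b) `&` E (~~ b) = set0.
  by case: b; case: sE => //= _; rewrite setIC.
have Ecl b : closed (E b).
  move=> z clz; have : Q z.
    by apply: cQ; apply: closureS clz; rewrite (QEb b); exact: subsetUl.
  rewrite (QEb b) => -[//|Ez];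
    suff : (closure (E b) `&` E (~~ b)) z by rewrite clE.
  by [].
(* The piece containing [x] is not known in advance, so it is called [E b]. *)
have [b Ebx] : exists b, E b x.
  by move: Qx; rewrite QE => -[]; [exists false | exists true].
have [M /set_nbhsP[U [oU EU UM]] MB] :
    filter_from (set_nbhs (E b)) closure (~` E (~~ b)).
  apply: (compact_normal hT cT (Ecl b)) => z Ez.
  apply: open_nbhs_nbhs; split; first exact/closed_openC/Ecl.
  by move=> Enz; suff : (closure (E b) `&` E (~~ b)) z;
    [rewrite clE | split=> //; exact: subset_closure].
pose V := ~` closure M.
have oV : open V by apply: closed_openC; exact: closed_closure.
have UV z : U z -> ~ V z by move=> /UM Mz; apply; exact: subset_closure.
have EV : E (~~ b) `<=` V by move=> z Ez /MB.
have [D [cD Dx DUV]] : exists D, [/\ clopen D, D x & D `<=` U `|` V].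
  apply: contrapT => noD.
  pose N := [set D | clopen D /\ D x].
  pose F := filter_from N (fun D => D `\` (U `|` V)).
  have FF : Filter F.
    apply: filter_from_filter; first by exists setT; split=> //; exact: clopenT.
    move=> D1 D2 [c1 D1x] [c2 D2x]; exists (D1 `&` D2).
      by split=> //; exact: clopenI.
    by move=> z [[]].
  have PF : ProperFilter F.
    apply: filter_from_proper => D [cD Dx]; apply: contrapT => DUV.
    apply: noD; exists D; split=> // z Dz; apply: contrapT => nUV.
    by apply: DUV; exists z.
  have cUV : closed (~` (U `|` V)) by apply: open_closedC; exact: openU.
  have [|z [nUVz clz]] := subclosed_compact cUV cT (@subsetT _ _) PF.
    by exists setT; [split=> //; exact: clopenT|move=> y []].
  have : Q z.
    move=> D [[oD cD] Dx]; apply: (cD) => W zW.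
    by apply: clz zW; exists D => // y [].
  by rewrite (QEb b) => -[/EU|/EV] ?; apply: nUVz; [left|right].
have cDU : clopen (D `&` U).
  case: cD => oD cD; split; first exact: openI.
  have -> : D `&` U = D `&` ~` V.
    apply/seteqP; split=> z [Dz]; first by move=> /UV.
    by case: (DUV z Dz).
  by apply: closedI => //; exact: open_closedC.
have [z Enz] := E0 (~~ b).
have : (D `&` U) z.
  by apply: (_ : Q z); [rewrite (QEb b); right|split=> //; split=> //;
    exact: EU].
by case=> _ /UV; apply; exact: EV.
Qed.

Lemma compact_zero_dimensional (T : topologicalType) : hausdorff_space T ->
  compact [set: T] -> totally_disconnected [set: T] -> zero_dimensional T.
Proof.
move=> hT cT tdT x y /eqP xy; apply: contrapT => noU; apply: xy.
suff : connected_component [set: T] x y by rewrite tdT.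
exists (\bigcap_(D in [set D | clopen D /\ D x]) D).
  split=> [D [] //|//|]; exact: quasi_component_connected.
move=> D [cD Dx]; apply: contrapT => nDy.
by apply: noU; exists D.
Qed.

(** The [g] such that inserting [g] anywhere in a product does not change its
    membership in [C] form a normal subgroup, and compactness makes it a
    neighbourhood of [1]. *)
Lemma clopen_normal_subgroup (H : topGroupType) (C : set H) :
  compact [set: H] -> clopen C -> C 1 ->
  exists N, [/\ normal_in N [set: H], open N & N `<=` C].
Proof.
move=> cH [oC cC] C1.
pose N := [set g | forall a b : H, C (a * g * b) <-> C (a * b)].
have sN : is_subgroup N.
  split=> [a b|g h Ng Nh a b]; first by rewrite mulg1.
  have := Nh (a * g * h^-1) b; rewrite mulgVK mulgA => ghb.
  exact: iff_trans (iff_sym ghb) (Ng a b).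
exists N; split.
- split=> // g x _ Nx a b.
  by have := Nx (a * g) (g^-1 * b); rewrite !mulgA mulgK.
- apply: nbhs1_subgroup_open => //.
  have /compact_near_coveringP : compact [set: H * H].
    by rewrite -setXTT; exact: compact_setX.
  move=> /(_ H (nbhs 1) (fun g p => C (p.1 * g * p.2) <-> C (p.1 * p.2)) _)
    ncov.
  apply: filterS (ncov _) => [g gN a b|[a b] _].
    exact: (gN (a, b)).
  have cf : continuous (@fst (H * H) H) by move=> ?; exact: cvg_fst.
  have cs : continuous (@snd (H * H) H) by move=> ?; exact: cvg_snd.
  have cf' : continuous (fun z : (H * H) * H => z.1.1).
    by move=> z; apply: continuous_comp; [exact: cf|exact: cvg_fst].
  have cs' : continuous (fun z : (H * H) * H => z.1.2).
    by move=> z; apply: continuous_comp; [exact: cf|exact: cvg_snd].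
  have c1 := continuousM (continuousM cf' cs) cs'.
  have c2 := continuousM cf' cs'.
  have oO (O : set H) : open O -> O (a * b) ->
      nbhs ((a, b), 1 : H)
        [set z | O (z.1.1 * z.2 * z.1.2) /\ O (z.1.1 * z.1.2)].
    move=> oO Oab; apply: filterI.
      by apply: c1; apply: open_nbhs_nbhs; rewrite /= mulg1.
    by apply: c2; apply: open_nbhs_nbhs.
  have [Cab|nCab] := pselect (C (a * b)).
    by apply: filterS (oO _ oC Cab) => z [].
  by apply: filterS (oO _ (closed_openC cC) nCab) => z [].
- move=> g /(_ 1 1).
  by rewrite mul1g !mulg1 => ->.
Qed.

(** Clopen neighbourhoods of [1] separate it from any other point, and each of
    them contains an open normal subgroup. *)
Lemma profinite_residual (H : topGroupType) (O : set H) : profinite H ->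
  is_subgroup O -> discrete_residual O = [set 1].
Proof.
move=> [cH tdH] sO; apply/seteqP; split=> [x Rx|_ ->]; last first.
  exact: subgroup1 (residual_subgroup O).
apply: contrapT => /eqP x1.
have [C [cC Cx C1]] := compact_zero_dimensional (@topgroup_hausdorff H) cH
  tdH x1.
have [N [nN oN NC]] : exists N, [/\ normal_in N [set: H], open N & N `<=` ~` C].
  by apply: clopen_normal_subgroup => //; exact: clopenC.
apply: (NC x) => //; move/(residualP _ openT): (residualS sO (@subsetT _ _) Rx).
exact.
Qed.

(** * Elementary groups *)

Lemma elementary_proper_image (H Q : topGroupType) (q : H -> Q) :
  tdlcsc Q -> proper_surjection q -> elementary H -> elementary Q.
Proof.
by move=> tQ pq eH; apply: elementary_quotient eH (proper_quotient_map tQ pq).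
Qed.

(** [H] is an extension of [Q] by the kernel of [q], which is profinite. *)
Lemma elementary_proper_preimage (H Q : topGroupType) (q : H -> Q) :
  tdlcsc H -> tdlcsc Q -> proper_surjection q -> elementary Q -> elementary H.
Proof.
move=> tH tQ pq eQ.
have s1 : is_subgroup [set 1 : Q].
  by split=> // x y -> ->; rewrite mulgV.
have sL := preimage_subgroup (proper_morphism pq) s1.
have re := sub_val_realizes sL; have cL := proper_kernel_compact pq.
have tL : tdlcsc (subgroup_type sL).
  by apply: (realizes_tdlcsc re tH); apply: compact_closed cL;
    exact: topgroup_hausdorff.
apply: (elementary_extension tH (proper_quotient_map tQ pq) re _ eQ).
apply: elementary_profinite => //; split; last by case: tL => -[].
have := realizes_compact re cL (@subset_refl _ _).
by congr compact; apply/seteqP; split=> // x _; exact: (realizes_mem re).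
Qed.

(** * The decomposition rank *)

Definition oone : ord := osucc ozero.

Lemma rank_oeq (K : topGroupType) (b c : ord) :
  oeq b c -> decomposition_rank K b -> decomposition_rank K c.
Proof.
move=> bc rK; case: rK bc => [{}K {}b K1 b1 bc|].
  by apply: rank_trivial => //; apply: oeq_trans b1; exact: oeq_sym.
move=> {}K O E e a {}b eK K1 exO cgO rO ra ba bc.
apply: (rank_nontrivial eK K1 exO cgO rO ra).
by apply: oeq_trans ba; exact: oeq_sym.
Qed.

Lemma rank_trivial_eq (K : topGroupType) (b : ord) :
  [set: K] = [set 1] -> decomposition_rank K b -> oeq b oone.
Proof. by move=> K1 rK; case: rK K1. Qed.

Lemma rank_ge1 (K : topGroupType) (b : ord) :
  decomposition_rank K b -> ole oone b.
Proof.
case=> [{}K {}b _ [] //|{}K O E e a {}b _ _ _ _ _ _ [_ ba]].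
by apply: ole_trans ba; apply/ole_succ; exact: ole0.
Qed.

Lemma realizes_trivial (E G : topGroupType) (e : E -> G) :
  realizes e [set 1] -> [set: E] = [set 1].
Proof.
move=> re; apply/seteqP; split=> // x _; apply: (realizes_inj re).
by rewrite (morphism1 (realizes_morphism re)); exact: (realizes_mem re).
Qed.

(** The bound is 2: all the residuals that enter into the rank are trivial and
    have rank 1. *)
Lemma profinite_rank_le (K : topGroupType) (b : ord) :
  profinite K -> decomposition_rank K b -> ole b (osucc oone).
Proof.
move=> pK rK; case: rK pK => [{}K {}b _ [b1 _] _|].
  by apply: ole_trans b1 _; apply/ole_succ; exact: ole0.
move=> {}K O E e a {}b _ _ [sO _ _] _ re ra [ba _] pK.
apply: ole_trans ba _; apply/ole_succ; apply: osup_le => i.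
have := re i; rewrite (profinite_residual pK (sO i).1) => /realizes_trivial E1.
by case: (rank_trivial_eq E1 (ra i)).
Qed.

Lemma profinite_rank (K : topGroupType) : tdlcsc K -> profinite K ->
  exists2 b, decomposition_rank K b & ole b (osucc oone).
Proof.
move=> tK pK; suff [b rb] : exists b, decomposition_rank K b.
  by exists b => //; exact: profinite_rank_le rb.
have [K1|K1] := pselect ([set: K] = [set 1]).
  by exists oone; apply: rank_trivial => //; split; exact: ole_refl.
have sT : is_subgroup [set: K] by [].
have sR := residual_subgroup [set: K].
exists (osucc (osup (fun=> oone))).
apply: (@rank_nontrivial K (fun=> setT) (fun=> subgroup_type sR)
          (fun=> @sub_val _ _ sR) (fun=> oone)) => //.
- exact: elementary_profinite.
- split=> //; first by move=> i; split=> //; exact: openT.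
  by apply/seteqP; split=> // x _; exists 0%N.
- move=> i; exists setT; first by case: pK.
  by apply/seteqP; split=> [x _ A [_ TA]|//]; exact: TA.
- by move=> i; exact: sub_val_realizes.
- move=> i; apply: rank_trivial; last by split; exact: ole_refl.
  apply: (@realizes_trivial _ K (@sub_val _ _ sR)).
  by rewrite -(profinite_residual pK sT); exact: sub_val_realizes.
- by split; exact: ole_refl.
Qed.

Lemma exhaustion_image (H Q : topGroupType) (q : H -> Q) (O : nat -> set H) :
  tdlcsc Q -> proper_surjection q -> exhaustion O ->
  exhaustion (fun i => q @` O i).
Proof.
move=> tQ pq [sO mO O1]; split=> [i|i j ij|].
- have [? ?] := sO i; split; first exact: (image_subgroup (proper_morphism pq)).
  exact: (proper_open_image tQ pq).
- exact/image_subset/mO.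
- apply/seteqP; split=> // y _; have [x <-] := proper_surj pq y.
  have : (\bigcup_i O i) x by rewrite O1.
  by case=> i _ Oix; exists i => //; exists x.
Qed.

Lemma exhaustion_preimage (H Q : topGroupType) (q : H -> Q) (O : nat -> set Q) :
  proper_surjection q -> exhaustion O -> exhaustion (fun i => q @^-1` O i).
Proof.
move=> pq [sO mO O1]; split=> [i|i j ij x|].
- have [? ?] := sO i; split;
    first exact: (preimage_subgroup (proper_morphism pq)).
  by move/continuousP: (proper_continuous pq); apply.
- exact: mO.
- by rewrite -preimage_bigcup O1.
Qed.

Lemma proper_trivial_codomain (H Q : topGroupType) (q : H -> Q) :
  tdlcsc H -> proper_surjection q -> [set: Q] = [set 1] -> profinite H.
Proof.
move=> [[tdH _] _] pq Q1; split=> //.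
have := proper_kernel_compact pq; congr compact.
by apply/seteqP; split=> // x _; rewrite -Q1.
Qed.

Lemma proper_trivial_domain (H Q : topGroupType) (q : H -> Q) :
  proper_surjection q -> [set: H] = [set 1] -> [set: Q] = [set 1].
Proof.
move=> pq H1; apply/seteqP; split=> // y _; have [x <-] := proper_surj pq y.
have -> : x = 1 by have : [set: H] x by []; rewrite H1.
exact: (morphism1 (proper_morphism pq)).
Qed.

Lemma succ_one_le (c : ord) : ole oone c -> ole (osucc oone) (oadd1 c).
Proof.
move=> c1; apply: ole_trans (oadd1_mono c1); apply: ole_trans (oadd1_succ _).
by apply/ole_succ => -[]; exists None; exact: (ole0 ozero).
Qed.

(** The double bound between ranks survives the passage from the residuals to
    the group. *)
Lemma rank_step (a c : nat -> ord) :
  (forall i, ole (c i) (a i) /\ ole (a i) (oadd1 (c i))) ->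
  ole (osucc (osup c)) (osucc (osup a)) /\
  ole (osucc (osup a)) (oadd1 (osucc (osup c))).
Proof.
move=> ca; split; first by apply/ole_succ/ole_sup => i; case: (ca i).
apply: ole_trans (oadd1_succ _); apply/ole_succ.
by apply: ole_trans (@oadd1_sup c); apply: ole_sup => i; case: (ca i).
Qed.

Lemma residual_sub_tdlcsc (K : topGroupType) (O : set K) (E : topGroupType)
    (e : E -> K) : tdlcsc K -> is_subgroup O -> open O ->
  realizes e (discrete_residual O) -> tdlcsc E.
Proof.
by move=> tK sO oO re; apply: (realizes_tdlcsc re tK); exact: residual_closed.
Qed.

(** The ranks [a i] of the residuals upstairs are controlled by induction, in
    terms of ranks [c i] of the residuals of the images.  When [Q] is trivial
    there is no exhaustion to work with, but then [H] is profinite. *)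
Lemma rank_proper_image (H : topGroupType) (b : ord) : decomposition_rank H b ->
  forall (Q : topGroupType) (q : H -> Q),
  tdlcsc H -> tdlcsc Q -> proper_surjection q ->
  exists2 c, decomposition_rank Q c & ole c b /\ ole b (oadd1 c).
Proof.
have one_le c : ole oone c -> ole oone (oadd1 c).
  by move=> c1; apply: ole_trans (succ_one_le c1); apply/ole_succ; exact: ole0.
elim=> {H b} [H b H1 [b1 b2] Q q tH tQ pq|].
  exists oone; last split=> //.
    apply: rank_trivial (proper_trivial_domain pq H1) _.
    by split; exact: ole_refl.
  by apply: ole_trans b1 _; apply: one_le; exact: ole_refl.
move=> H O E e a b eH H1 exO cgO re ra IH ba Q q tH tQ pq.
have rb := rank_nontrivial eH H1 exO cgO re ra ba.
have [Q1|Q1] := pselect ([set: Q] = [set 1]).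
  exists oone; first by apply: rank_trivial => //; split; exact: ole_refl.
  split; first exact: rank_ge1 rb.
  have pH := proper_trivial_codomain tH pq Q1.
  by apply: ole_trans (profinite_rank_le pH rb) (succ_one_le (ole_refl _)).
have [sO _ _] := exO.
have exqO := exhaustion_image tQ pq exO; have [sqO _ _] := exqO.
have sR i := residual_subgroup (q @` O i).
have re' i := sub_val_realizes (sR i).
have /choice[c cP] i : exists c, decomposition_rank (subgroup_type (sR i)) c /\
    (ole c (a i) /\ ole (a i) (oadd1 c)).
  have [sOi oOi] := sO i; have [sqOi oqOi] := sqO i.
  have [r pr] := proper_restrict pq (residual_closed sOi oOi)
    (residual_image tQ pq sOi oOi) (re i) (re' i).
  have [] := IH i _ r _ _ pr; last by move=> c; exists c.
    exact: residual_sub_tdlcsc (re i).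
  exact: residual_sub_tdlcsc (re' i).
have [cb bc] := rank_step (fun i => (cP i).2).
exists (osucc (osup c)).
  apply: (rank_nontrivial _ Q1 exqO _ re' (fun i => (cP i).1)).
  - exact: elementary_proper_image tQ pq eH.
  - by move=> i; exact: (compactly_generated_image pq).
  - by split; exact: ole_refl.
case: ba => ba ab; split; first exact: ole_trans ab.
exact: ole_trans bc.
Qed.

(** The same comparison, by induction on a derivation for the quotient: a rank
    has to be constructed for [H], by pulling back the exhaustion of [Q]. *)
Lemma rank_proper_preimage (Q : topGroupType) (c : ord) :
  decomposition_rank Q c ->
  forall (H : topGroupType) (q : H -> Q),
  tdlcsc H -> tdlcsc Q -> proper_surjection q ->
  exists2 b, decomposition_rank H b & ole c b /\ ole b (oadd1 c).
Proof.
elim=> {Q c} [Q c Q1 [c1 c2] H q tH tQ pq|].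
  have [b rb b2] := profinite_rank tH (proper_trivial_codomain tH pq Q1).
  exists b => //; split; first by apply: ole_trans c1 (rank_ge1 rb).
  by apply: ole_trans b2 _; exact: succ_one_le.
move=> Q O E e c b eQ Q1 exO cgO re rc IH bc H q tH tQ pq.
have H1 : [set: H] <> [set 1] by move/(proper_trivial_domain pq).
have [sO _ _] := exO.
have exqO := exhaustion_preimage pq exO; have [sqO _ _] := exqO.
have sR i := residual_subgroup (q @^-1` O i).
have re' i := sub_val_realizes (sR i).
have /choice[a aP] i : exists a, decomposition_rank (subgroup_type (sR i)) a /\
    (ole (c i) a /\ ole a (oadd1 (c i))).
  have [sOi oOi] := sO i; have [sqOi oqOi] := sqO i.
  have qR : q @` discrete_residual (q @^-1` O i) = discrete_residual (O i).
    rewrite (residual_image tQ pq sqOi oqOi); congr discrete_residual.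
    by rewrite image_preimage //; case: pq.
  have [r pr] := proper_restrict pq (residual_closed sqOi oqOi) qR (re' i)
    (re i).
  have [] := IH i _ r _ _ pr; last by move=> a; exists a.
    exact: residual_sub_tdlcsc (re' i).
  exact: residual_sub_tdlcsc (re i).
have [cb ab] := rank_step (fun i => (aP i).2).
exists (osucc (osup a)).
  apply: (rank_nontrivial _ H1 exqO _ re' (fun i => (aP i).1)).
  - exact: elementary_proper_preimage tQ pq eQ.
  - by move=> i; exact: (compactly_generated_preimage pq).
  - by split; exact: ole_refl.
case: bc => bc cb'; split; first exact: ole_trans cb.
by apply: ole_trans ab _; exact: oadd1_mono.
Qed.

Lemma rank_transfinite_proper (H Q : topGroupType) (q : H -> Q) (b : ord) :
  tdlcsc H -> tdlcsc Q -> proper_surjection q -> transfinite b ->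
  decomposition_rank H b <-> decomposition_rank Q b.
Proof.
move=> tH tQ pq tb; split=> [rH|rQ].
  have [c rc [cb bc]] := rank_proper_image rH tH tQ pq.
  apply: rank_oeq rc; apply: oeq_sym; apply: oeq_transfinite => //.
  by apply: transfinite_oadd1; exact: ole_trans bc.
have [c rc [bc cb]] := rank_proper_preimage rQ tH tQ pq.
by apply: rank_oeq rc; exact: oeq_transfinite.
Qed.

(** * A common cover of two completions *)

Lemma compact_bigcup (T : topologicalType) (I : choiceType) (D : set I)
    (F : I -> set T) :
  finite_set D -> (forall i, D i -> compact (F i)) ->
  compact (\bigcup_(i in D) F i).
Proof.
move=> /finite_fsetP[X ->] cF; rewrite bigcup_fset big_seq.
by apply: bigsetU_compact => i; exact: cF.
Qed.

Lemma fst_continuous (T U : topologicalType) : continuous (@fst T U).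
Proof. by move=> x; exact: cvg_fst. Qed.

Lemma snd_continuous (T U : topologicalType) : continuous (@snd T U).
Proof. by move=> x; exact: cvg_snd. Qed.

Lemma totally_disconnected_image (T U : topologicalType) (f : T -> U) (x y :
  T) :
  continuous f -> totally_disconnected [set: U] ->
  connected_component [set: T] x y -> f x = f y.
Proof.
move=> cf tdU [C [Cx _ coC] Cy].
suff : connected_component [set: U] (f x) (f y) by rewrite tdU.
exists (f @` C); last by exists y.
split=> //.
by apply: connected_continuous_connected coC _; exact/continuous_subspaceT.
Qed.

Lemma tdlcsc_prod (K L : topGroupType) :
  tdlcsc K -> tdlcsc L -> tdlcsc (K * L)%type.
Proof.
move=> [[tdK lcK] [B cB [oB bB]]] [[tdL lcL] [C cC [oC bC]]]; split;
  first split.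
- move=> x _; apply/seteqP; split=> [y xy|_ ->]; last first.
    exact: connected_component_refl.
  have := totally_disconnected_image (@snd_continuous K L) tdL xy.
  have := totally_disconnected_image (@fst_continuous K L) tdK xy.
  by case: x y {xy} => [x1 x2] [y1 y2] /= -> ->.
- apply/(locally_compactP (@topgroup_hausdorff (K * L)%type)) => -[x y].
  have [X xX cX] := (locally_compactP (@topgroup_hausdorff K)).1 lcK x.
  have [Y yY cY] := (locally_compactP (@topgroup_hausdorff L)).1 lcL y.
  by exists (X `*` Y); [exists (X, Y)|exact: compact_setX].
- exists [set V.1 `*` V.2 | V in B `*` C].
    apply: card_le_trans (card_image_le _ _) _; exact: countableX.
  split=> [_ [[V W] [BV CW] <-]|[x y] U [[V W] /= [xV yW] VWU]].
    rewrite openE => -[x y] [/= Vx Wy]; exists (V, W) => //.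
    by split; apply: open_nbhs_nbhs; split=> //; [exact: oB|exact: oC].
  have [V' [BV' V'x] V'V] := bB _ _ xV.
  have [W' [CW' W'y] W'W] := bC _ _ yW.
  exists (V' `*` W'); first by split=> //; exists (V', W').
  by move=> [z t] [/V'V Vz /W'W Wt]; apply: VWU.
Qed.

Lemma closure_subgroup (K : topGroupType) (A : set K) :
  is_subgroup A -> is_subgroup (closure A).
Proof.
move=> sA; split; first exact/subset_closure/sA.1.
move=> x y clx cly U xyU.
have cd : continuous (fun p : K * K => p.1 / p.2).
  apply: (@continuousM _ K fst (fun p => p.2^-1)); first exact: fst_continuous.
  by apply: (@continuousV _ K snd); exact: snd_continuous.
have [[V W] /= [xV yW] VWU] := cd (x, y) U xyU.
have [a [Aa Va]] := clx _ xV; have [b [Ab Wb]] := cly _ yW.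
exists (a / b); split; first exact: sA.2.
exact: (VWU (a, b)).
Qed.

(** By density every point of [K] has a neighbourhood [V], a coset of [R] by an
    element of the image, and its preimage is a coset of the preimage of [R],
    hence compact.  So [f] is proper; being closed with dense image, it is
    onto. *)
Lemma proper_of_compact_open (E K : topGroupType) (f : E -> K) (R : set K) :
  tdlc K -> monoid_morphism f -> continuous f -> dense (range f) ->
  is_subgroup R -> open R -> compact (f @^-1` R) -> proper_surjection f.
Proof.
move=> [_ lcK] mf cf df sR oR cR.
have pf C : compact C -> compact (f @^-1` C).
  move=> cC; rewrite compact_ultra => F UF FC.
  have PF : ProperFilter (f @ F) by exact: fmap_proper_filter.
  have [y [Cy cly]] := cC (f @ F) PF FC.
  (* [V] is [t R], where [t = f s] is close to [y]. *)
  have [||t [Rt [s _ st]]] := df [set t | R (y^-1 * t)].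
  - by exists y; rewrite /= mulVg; exact: sR.1.
  - exact: open_ltransl.
  pose V := [set z | R (t^-1 * z)].
  have yV : nbhs y V.
    apply: open_nbhs_nbhs; split; first exact: open_ltransl.
    by rewrite /V /= -[t^-1 * y]invgK invgM invgK; apply: subgroupV.
  have cV : compact (f @^-1` V).
    have -> : f @^-1` V = [set s * z | z in f @^-1` R].
      apply/seteqP; split=> [z Vz|_ [z Rz <-]].
        exists (s^-1 * z); last exact: mulVKg.
        by rewrite /= (morphismM mf) (morphismV mf) st.
      by rewrite /V /= (morphismM mf) st mulKg.
    by apply: image_compact => //; exact: continuous_ltransl.
  have FV : F (f @^-1` V).
    have [//|FnV] := in_ultra_setVsetC (f @^-1` V) UF.
    by have [z [nVz Vz]] := cly (~` V) V FnV yV.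
  have PF' : ProperFilter F by exact: ultra_proper.
  have [x [Vx clx]] := cV F PF' FV; rewrite ultra_cvg_clusterE in clx.
  exists x; split=> //.
  have clC : closed (f @^-1` C).
    move/continuous_closedP: cf; apply; apply: compact_closed => //.
    exact: topgroup_hausdorff.
  apply: clC => U xU; have FU : F U by apply: clx.
  exact: filter_ex (filterI FC FU).
split=> //; apply/seteqP; split=> // y _.
have : closed (f @` setT).
  by apply: proper_closed => //; exact: topgroup_hausdorff.
apply=> U; rewrite nbhsE => -[O [oO Oy] OU].
have [|z [Oz rz]] := df O _ oO; first by exists y.
by exists z; split=> //; exact: OU.
Qed.

(** Each of the finitely many cosets making up [U] is mapped by [psi] into a
    translate of [C]. *)
Lemma commensurate_image_compact (G L : topGroupType) (psi : G -> L)
    (U : set G) (C : set L) :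
  monoid_morphism psi -> compact C ->
  finite_index (U `&` psi @^-1` C) U -> is_subgroup U -> is_subgroup C ->
  exists2 X, compact X & psi @` U `<=` X.
Proof.
move=> mpsi cC fin sU sC; set W := U `&` _ in fin.
pose cosets := [set [set x * w | w in W] | x in U].
have /choice[rep repP] S : exists x, cosets S -> S = [set x * w | w in W].
  have [[x _ <-]|] := pselect (cosets S); first by exists x.
  by exists 1.
exists (\bigcup_(S in cosets) [set psi (rep S) * c | c in C]).
  apply: compact_bigcup => // S _; apply: image_compact => //.
  exact: continuous_ltransl.
move=> _ [u Uu <-]; pose S := [set u * w | w in W].
have cS : cosets S by exists u.
have : S u.
  exists 1; last exact: mulg1.
  by split; [exact: sU.1|exact: (preimage_subgroup mpsi sC).1].
rewrite (repP S cS) => -[w [_ Cw] wu]; exists S => //.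
by exists (psi w) => //; rewrite -wu (morphismM mpsi).
Qed.

(** The symmetric hypothesis [fgK] says that [(f, g)] is proper, as a closed
    embedding of [E] into [K * L] is; exchanging [f] and [g] yields the other
    projection. *)
Section CommonCover.
Context {G E K L : topGroupType} (j : G -> E) (f : E -> K) (g : E -> L).
Hypothesis (mf : monoid_morphism f) (cf : continuous f) (cg : continuous g).
Hypothesis (dj : dense (range j)) (dfj : dense (range (f \o j))).
Hypothesis fgK : forall X Y, compact X -> compact Y ->
  compact (f @^-1` X `&` g @^-1` Y).

(** By density of [G] in [E], the inclusion of the preimage of [R] in that of
    [Y] need only be tested on [G]. *)
Lemma proper_first_projection (R : set K) (Y : set L) : tdlc K ->
  is_subgroup R -> compact R -> open R -> compact Y ->
  (forall x, R (f (j x)) -> Y (g (j x))) -> proper_surjection f.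
Proof.
move=> tK sR cR oR cY RY; apply: (proper_of_compact_open tK mf cf _ sR oR).
  move=> O O0 oO; have [z [Oz [x _ xz]]] := dfj O0 oO.
  by exists z; split=> //; exists (j x).
have -> : f @^-1` R = f @^-1` R `&` g @^-1` Y; last exact: fgK.
apply/seteqP; split=> [x Rx|x []//]; split=> //; apply: contrapT => nYx.
have [||z [[Rz nYz] [t _ tz]]] := dj (O := f @^-1` R `&` g @^-1` (~` Y)).
- by exists x.
- apply: openI; first by move/continuousP: cf; apply.
  move/continuousP: cg; apply; apply: closed_openC; apply: compact_closed => //.
  exact: topgroup_hausdorff.
by apply: nYz; rewrite -tz; apply: RY; rewrite tz.
Qed.

End CommonCover.

(** Only here do the sizes enter: their equality says that the preimages [U]
    and [V] of the two compact open subgroups are commensurate. *)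
Lemma common_cover (G K L : topGroupType) (phi : G -> K) (psi : G -> L)
    (alpha : set (set G)) :
  tdlcsc K -> tdlcsc L -> completion_of_size phi alpha ->
  completion_of_size psi alpha ->
  exists E : topGroupType, exists f : E -> K, exists g : E -> L,
    [/\ tdlcsc E, proper_surjection f & proper_surjection g].
Proof.
move=> tK tL [[tdK mphi cphi dphi] [R [sR cR oR aR]]].
move=> [[tdL mpsi cpsi dpsi] [S [sS cS oS aS]]].
pose U := phi @^-1` R; pose V := psi @^-1` S.
have sU : is_subgroup U := preimage_subgroup mphi sR.
have sV : is_subgroup V := preimage_subgroup mpsi sS.
have [finU finV] : commensurate U V.
  suff : comm_class V U by case.
  rewrite -aS aR; split=> //.
    move/continuous_closedP: cphi; apply; apply: compact_closed => //.
    exact: topgroup_hausdorff.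
  have : finite_index (U `&` U) U.
    rewrite setIid; apply: (@sub_finite_set _ _ [set U]) => [_ [x Ux <-]|].
      apply/seteqP; split=> [_ [w Uw <-]|w Uw]; first exact: subgroupM.
      exists (x^-1 * w); last exact: mulVKg.
      by apply: subgroupM => //; exact: subgroupV.
    exact: finite_set1.
  by [].
have [X cX UX] := commensurate_image_compact mpsi cS finU sU sS.
have [Y cY VY] : exists2 Y, compact Y & phi @` V `<=` Y.
  apply: (commensurate_image_compact mphi cR _ sV sR).
  by rewrite setIC.
pose h (x : G) : (K * L)%type := (phi x, psi x).
have mh : monoid_morphism h.
  split; first by rewrite /h (morphism1 mphi) (morphism1 mpsi).
  by move=> x y; rewrite /h (morphismM mphi) (morphismM mpsi).
have sh : is_subgroup (range h) by apply: (image_subgroup mh); split.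
pose sD := closure_subgroup sh.
pose E : topGroupType := subgroup_type sD.
have re : realizes (@sub_val _ _ sD : E -> (K * L)%type) (closure (range h)).
  exact: sub_val_realizes.
have cD : closed (closure (range h)) by exact: closed_closure.
have hD x : closure (range h) (h x) by apply: subset_closure; exists x.
pose j (x : G) : E := sub_elt sD (hD x).
pose f (x : E) := (sub_val x).1; pose g (x : E) := (sub_val x).2.
have mf : monoid_morphism f by [].
have mg : monoid_morphism g by [].
have cf : continuous f.
  move=> x; apply: (@continuous_comp _ _ _ (@sub_val _ _ sD) fst).
    exact: sub_val_continuous.
  exact: fst_continuous.
have cg : continuous g.
  move=> x; apply: (@continuous_comp _ _ _ (@sub_val _ _ sD) snd).
    exact: sub_val_continuous.
  exact: snd_continuous.
have dj : dense (range j).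
  move=> O [x Ox]; rewrite (realizes_open re) => -[B oB OB].
  have Bx : B (sub_val x) by rewrite -OB in Ox.
  have [_ [[t _ <-] Bt]] := sub_valP x _ (open_nbhs_nbhs (conj oB Bx)).
  by exists (j t); split; [rewrite -OB|exists t].
have fgK X' Y' : compact X' -> compact Y' -> compact (f @^-1` X' `&` g @^-1`
  Y').
  move=> cX' cY'.
  have := realizes_compact re (compact_closedI (compact_setX cX' cY') cD)
    (@subIsetr _ _ _).
  congr compact; apply/seteqP; split=> [x [] //|x [Xx Yx]].
  by split=> //; exact: sub_valP.
exists E, f, g; split.
- exact: (realizes_tdlcsc re (tdlcsc_prod tK tL) cD).
- apply: (proper_first_projection mf cf cg dj dphi fgK tdK sR cR oR cX) => x Rx.
  by apply: UX; exists x.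
- apply: (proper_first_projection mg cg cf dj dpsi _ tdL sS cS oS cY) => [|x
    Sx].
    by move=> X' Y' cX' cY'; rewrite setIC; exact: fgK.
  by apply: VY; exists x.
Qed.

Theorem theorem1p6 (G : topGroupType) (alpha : set (set G))
    (halpha : is_size alpha) :
  ((forall H : topGroupType, sc_completion_of_size alpha H -> elementary H) \/
   (forall H : topGroupType, sc_completion_of_size alpha H -> ~ elementary H))
  /\
  (forall beta : ord, transfinite beta ->
    (forall H : topGroupType, sc_completion_of_size alpha H ->
       elementary H /\ decomposition_rank H beta) \/
    (forall H : topGroupType, sc_completion_of_size alpha H ->
       ~ (elementary H /\ decomposition_rank H beta))).
Proof.
have cover (H K : topGroupType) : sc_completion_of_size alpha H ->
    sc_completion_of_size alpha K -> exists E : topGroupType,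
    exists f : E -> H, exists g : E -> K,
    [/\ tdlcsc H, tdlcsc K, tdlcsc E, proper_surjection f & proper_surjection
      g].
  move=> [scH [phi cphi]] [scK [psi cpsi]].
  have tH : tdlcsc H by split=> //; case: cphi => -[].
  have tK : tdlcsc K by split=> //; case: cpsi => -[].
  have [E [f [g [tE pf pg]]]] := common_cover tH tK cphi cpsi.
  by exists E, f, g.
(* A property inherited by all other completions of size [alpha] as soon as
   one of them has it is subject to the dichotomy. *)
have transfer (P : topGroupType -> Prop) :
    (forall H K, sc_completion_of_size alpha H ->
       sc_completion_of_size alpha K -> P H -> P K) ->
    (forall H, sc_completion_of_size alpha H -> P H) \/
    (forall H, sc_completion_of_size alpha H -> ~ P H).
  move=> PHK.
  have [[H [aH PH]]|noH] := pselect (exists H, sc_completion_of_size alpha H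
    /\ P H).
    by left=> K aK; exact: PHK PH.
  by right=> H aH PH; apply: noH; exists H.
have elem H K : sc_completion_of_size alpha H -> sc_completion_of_size alpha
  K ->
    elementary H -> elementary K.
  move=> aH aK eH; have [E [f [g [tH tK tE pf pg]]]] := cover H K aH aK.
  apply: (elementary_proper_image tK pg).
  exact: (elementary_proper_preimage tE tH pf).
split; first exact: transfer.
move=> beta tb; apply: transfer => H K aH aK [eH rH]; split;
  first exact: elem eH.
have [E [f [g [tH tK tE pf pg]]]] := cover H K aH aK.
apply/(rank_transfinite_proper tE tK pg tb).
exact/(rank_transfinite_proper tE tH pf tb).
Qed.
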